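(* There exist absolute constants $c_1,c_2>0$ such that the following holds. Let $n,N$ be positive integers with $n\le N\le e^n$, let $X_1,\dots,X_N$ be independent random vectors uniformly distributed in $D_2^n$, and let $K_N=\mathrm{conv}\{\pm X_1,\dots,\pm X_N\}$. Then $$c_1\sqrt{\log N}\ \le\ \mathbb{E}\,w(K_N)\ \le\ c_2\sqrt{\log N}.$$
   Context: $D_2^n=B_2^n/|B_2^n|^{1/n}$ is the Euclidean ball of volume $1$ centered at the origin in $\mathbb{R}^n$. The support function of a compact convex set $K$ is $h_K(\theta)=\max\{\langle x,\theta\rangle:x\in K\}$, and its mean width is $w(K)=\int_{S^{n-1}}h_K(\theta)\,d\mu(\theta)$, where $\mu$ is the uniform (rotation invariant) probability measure on $S^{n-1}$. ''Absolute constant'' means independent of $n,N$.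
   Formalization: The case n = N = 1 is excluded by assuming N > 1: there log N = 0 while E w(K_1) = E|X_1| = 1/4 > 0, so the upper bound fails as stated. *)

(* Defs.v *)
From HB Require Import structures.
From mathcomp Require Import all_boot all_order all_algebra.
From mathcomp Require Import all_classical all_reals all_analysis.

Set Implicit Arguments.
Unset Strict Implicit.
Unset Printing Implicit Defensive.

Import Order.TTheory GRing.Theory Num.Theory.
Import numFieldNormedType.Exports.

Local Open Scope classical_set_scope.
Local Open Scope ring_scope.

Definition measure_row_display : measure_display -> measure_display.
Proof. exact. Qed.

(* The sigma-algebra on row vectors generated by the coordinates; on
   'rV[R]_n it is the Borel sigma-algebra of R^n. *)
Section measurable_row.
Context {d} {T : measurableType d} (n : nat).

Let coors : 'I_n -> 'rV[T]_n -> T := fun i x => x ord0 i.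

Let row_set0 : g_sigma_preimage coors set0.
Proof. exact: sigma_algebra0. Qed.

Let row_setC A : g_sigma_preimage coors A -> g_sigma_preimage coors (~` A).
Proof. exact: sigma_algebraC. Qed.

Let row_bigcup (F : _^nat) : (forall i, g_sigma_preimage coors (F i)) ->
  g_sigma_preimage coors (\bigcup_i (F i)).
Proof. exact: sigma_algebra_bigcup. Qed.

HB.instance Definition _ := @isMeasurable.Build (measure_row_display d)
  'rV[T]_n (g_sigma_preimage coors) row_set0 row_setC row_bigcup.

End measurable_row.

Lemma measurable_coord d (T : measurableType d) n (i : 'I_n) :
  measurable_fun [set: 'rV[T]_n] (fun x : 'rV[T]_n => x ord0 i).
Proof.
move=> _ Y mY; rewrite setTI; apply: sub_sigma_algebra => /=.
rewrite -bigcup_seq/=; exists i => /=; first by rewrite mem_index_enum.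
by exists Y => //; rewrite setTI.
Qed.

Lemma measurable_fun_rowP d1 d2 (T1 : measurableType d1)
    (T2 : measurableType d2) n (f : T1 -> 'rV[T2]_n) :
  measurable_fun [set: T1] f <->
  forall i, measurable_fun [set: T1] (fun x => f x ord0 i).
Proof.
split=> [mf i|mf].
  exact: (measurableT_comp (measurable_coord i) mf).
move=> _ A mA; rewrite setTI.
have : sigma_algebra [set: 'rV[T2]_n]
    [set B | measurable (f @^-1` B)].
  split => /=.
  - by rewrite preimage_set0.
  - by move=> B mB; rewrite setTD preimage_setC; exact: measurableC.
  - by move=> F mF; rewrite preimage_bigcup; exact: bigcup_measurable.
move=> sB; apply: (smallest_sub sB _ mA) => B.
rewrite -bigcup_seq/= => -[i _ [Y mY <-]] /=.
by have := mf i measurableT Y mY; rewrite !setTI.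
Qed.

Definition row_cons (R : realType) n (p : R * 'rV[R]_n) : 'rV[R]_n.+1 :=
  row_mx (p.1)%:M p.2.

Lemma row_consE (R : realType) n (p : R * 'rV[R]_n) (i : 'I_n.+1) :
  row_cons p ord0 i = if unlift ord0 i is Some j then p.2 ord0 j else p.1.
Proof.
rewrite /row_cons; case: unliftP => [j ->|->].
  have -> : lift ord0 j = rshift 1 j by exact/val_inj.
  by rewrite (row_mxEr (p.1)%:M).
have -> : ord0 = lshift n ord0 :> 'I_(1 + n) by exact/val_inj.
by rewrite (row_mxEl (p.1)%:M) mxE eqxx.
Qed.

Lemma measurable_row_cons (R : realType) n :
  measurable_fun [set: R * 'rV[R]_n] (@row_cons R n).
Proof.
apply/measurable_fun_rowP => i.
under eq_fun do rewrite row_consE.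
case: (unlift ord0 i) => [j|]; last exact: measurable_fst.
exact: (measurableT_comp (measurable_coord j) measurable_snd).
Qed.

Definition row_uncons (R : realType) n (v : 'rV[R]_n.+1) : R * 'rV[R]_n :=
  (v ord0 ord0, \row_j v ord0 (lift ord0 j)).

Lemma row_consK (R : realType) n : cancel (@row_cons R n) (@row_uncons R n).
Proof.
move=> [x v]; rewrite /row_uncons row_consE unlift_none/=; congr pair.
by apply/rowP => j; rewrite mxE row_consE liftK.
Qed.

Lemma measurable_row_uncons (R : realType) n :
  measurable_fun [set: 'rV[R]_n.+1] (@row_uncons R n).
Proof.
apply: measurable_fun_pair; first exact: measurable_coord.
apply/measurable_fun_rowP => j.
under eq_fun do rewrite mxE.
exact: measurable_coord.
Qed.

Section lebesgue_cons.
Local Open Scope ereal_scope.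
Context (R : realType) (n : nat).
Variable m : {sigma_finite_measure set 'rV[R]_n -> \bar R}.

Let prod : {measure set (measurableTypeR R * 'rV[R]_n)%type -> \bar R} :=
  [the {measure set _ -> \bar R} of lebesgue_measure \x m].

Definition lebesgue_cons : set 'rV[R]_n.+1 -> \bar R :=
  pushforward (lebesgue_measure \x m) (@row_cons R n).

Let mcons := @measurable_row_cons R n.

Let lebesgue_cons0 : lebesgue_cons set0 = 0.
Proof. by rewrite /lebesgue_cons /pushforward preimage_set0 (measure0 prod). Qed.

Let lebesgue_cons_ge0 A : 0 <= lebesgue_cons A.
Proof. exact: (measure_ge0 prod). Qed.

Let lebesgue_cons_sigma_additive : semi_sigma_additive lebesgue_cons.
Proof.
move=> F mF tF mUF; rewrite /lebesgue_cons /pushforward preimage_bigcup.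
apply: (measure_semi_sigma_additive (s := prod)).
- by move=> k; rewrite -[X in measurable X]setTI; exact: mcons.
- apply/trivIsetP => /= i j _ _ ij; rewrite -preimage_setI.
  by move/trivIsetP : tF => /(_ _ _ _ _ ij) ->//; rewrite preimage_set0.
- by rewrite -preimage_bigcup -[X in measurable X]setTI; exact: mcons.
Qed.

HB.instance Definition _ := isMeasure.Build _ _ _ lebesgue_cons
  lebesgue_cons0 lebesgue_cons_ge0 lebesgue_cons_sigma_additive.

Let lebesgue_cons_sigma_finite : sigma_finite setT lebesgue_cons.
Proof.
have /sigma_finiteP[F [TF ndF Foo]] := sigma_finiteT (@lebesgue_measure R).
have /sigma_finiteP[G [TG ndG Goo]] := sigma_finiteT m.
exists (fun k => @row_uncons R n @^-1` (F k `*` G k)).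
  apply/seteqP; split=> // v _ /=.
  have [i _ Fi] : (\bigcup_k F k) (row_uncons v).1 by rewrite -TF.
  have [j _ Gj] : (\bigcup_k G k) (row_uncons v).2 by rewrite -TG.
  exists (maxn i j) => //; split.
    by move: Fi; exact/subsetPset/ndF/leq_maxl.
  by move: Gj; exact/subsetPset/ndG/leq_maxr.
move=> k; have [mF Fk] := Foo k; have [mG Gk] := Goo k; split.
  rewrite -[X in measurable X]setTI; apply: measurable_row_uncons => //.
  exact: measurableX.
rewrite /lebesgue_cons /pushforward -comp_preimage.
have -> : (@row_uncons R n \o @row_cons R n) = idfun.
  by apply/funext => p /=; rewrite row_consK.
by rewrite preimage_id product_measure1E// lte_mul_pinfty// ge0_fin_numE.
Qed.

HB.instance Definition _ := Measure_isSigmaFinite.Build _ _ _ lebesgue_cons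
  lebesgue_cons_sigma_finite.

End lebesgue_cons.

Fixpoint lebesgue_row (R : realType) n :
    {sigma_finite_measure set 'rV[R]_n -> \bar R} :=
  if n is k.+1 then lebesgue_cons (lebesgue_row R k)
  else @dirac _ 'rV[R]_0 0 R.

Lemma lebesgue_row_box (R : realType) n (A : 'I_n -> set R) :
  (forall i, measurable (A i)) ->
  lebesgue_row R n [set x | forall i, A i (x ord0 i)] =
  (\prod_(i < n) lebesgue_measure (A i))%E.
Proof.
elim: n A => [|n IHn] A mA.
  rewrite big_ord0 /= diracE (_ : _ \in _) // inE => -[].
  by [].
rewrite big_ord_recl -IHn; last by move=> i; exact: mA.
rewrite [LHS]/= /lebesgue_cons /pushforward.
rewrite [X in (_ \x _)%E X](_ : _ = A ord0 `*`
    [set x : 'rV[R]_n | forall i, A (lift ord0 i) (x ord0 i)]); last first.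
  apply/seteqP; split=> -[x v] /=.
    move=> Axv; split => [|i]; first by have := Axv ord0; rewrite row_consE unlift_none.
    by have := Axv (lift ord0 i); rewrite row_consE liftK.
  move=> [Ax Av] i; rewrite row_consE; case: unliftP => [j ->|->//].
  exact: Av.
rewrite product_measure1E//; first exact: mA.
have -> : [set x : 'rV[R]_n | forall i, A (lift ord0 i) (x ord0 i)] =
    \bigcap_i ((fun x : 'rV[R]_n => x ord0 i) @^-1` A (lift ord0 i)).
  by apply/seteqP; split=> x /= h i; [move=> _; exact: h|exact: h].
apply: fin_bigcap_measurable => // i _.
by rewrite -[X in measurable X]setTI; exact: measurable_coord.
Qed.

Definition dot (R : realType) n (x y : 'rV[R]_n) : R :=
  \sum_(i < n) x ord0 i * y ord0 i.

(* The library norm on 'rV[R]_n is the max norm. *)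
Definition euclidean_norm (R : realType) n (x : 'rV[R]_n) : R :=
  Num.sqrt (dot x x).

Definition euclidean_ball (R : realType) n : set 'rV[R]_n :=
  [set x | euclidean_norm x <= 1].

Definition euclidean_sphere (R : realType) n : set 'rV[R]_n :=
  [set x | euclidean_norm x = 1].

Definition volume (R : realType) n (A : set 'rV[R]_n) : R :=
  fine (lebesgue_row R n A).

Definition unit_volume_ball (R : realType) n : set 'rV[R]_n :=
  [set (volume (@euclidean_ball R n) `^ n%:R^-1)^-1 *: x
    | x in @euclidean_ball R n].

Definition uniformly_distributed d (T : measurableType d) (R : realType)
    (P : probability T R) n (X : {RV P >-> 'rV[R]_n}) (D : set 'rV[R]_n) :=
  forall A : set 'rV[R]_n, measurable A ->
    distribution P X A = ((volume D)^-1%:E * lebesgue_row R n (A `&` D))%E.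

Definition mutually_independent d d' (T : measurableType d)
    (T' : measurableType d') (R : realType) (P : probability T R)
    (I : finType) (X : I -> {RV P >-> T'}) :=
  forall (J : {set I}) (A : I -> set T'), (forall i, measurable (A i)) ->
    P (\bigcap_(i in [set` J]) X i @^-1` A i) =
    (\prod_(i in J) P (X i @^-1` A i))%E.

(* Invariance is under all of O(n), reflections included, so that mu is also
   determined when n = 1, where SO(1) is trivial and the sphere is {-1, 1}. *)
Definition uniform_on_sphere (R : realType) n (mu : probability 'rV[R]_n R) :=
  mu (@euclidean_sphere R n) = 1%E /\
  forall Q : 'M[R]_n, Q *m Q^T = 1%:M ->
  forall A : set 'rV[R]_n, measurable A -> mu ((mulmxr Q) @^-1` A) = mu A.

Definition convex_hull (R : realType) n (A : set 'rV[R]_n) : set 'rV[R]_n :=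
  smallest (@convex_set R 'rV[R]_n) A.

Definition support_function (R : realType) n (K : set 'rV[R]_n)
    (theta : 'rV[R]_n) : R :=
  sup [set dot x theta | x in K].

Definition mean_width (R : realType) n (mu : probability 'rV[R]_n R)
    (K : set 'rV[R]_n) : R :=
  \int[mu]_(theta in @euclidean_sphere R n) support_function K theta.

Definition random_polytope (R : realType) n N (X : 'I_N -> 'rV[R]_n) :
    set 'rV[R]_n :=
  convex_hull (range X `|` range (fun i => - X i)).

(* Main.v *)
Require Import Defs.
From mathcomp Require Import all_boot all_order all_algebra.
From mathcomp Require Import all_classical all_reals all_analysis.
From mathcomp Require Import measurable_realfun.
From mathcomp Require Import ring lra.

(** In direction [t] the support function of the polytope spanned by the
    [+- x_i] is [max_i |<x_i, t>|], so the expected mean width is the integral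
    of [max_i |<X_i, t>|] over the points and over the sphere. The ball [D] of
    volume one has radius [r] with [n / C^2 <= r^2 <= n / 4] for a constant [C]
    ([unit_volume_ballE]): the unit ball contains a cube of side [2 / sqrt n],
    and its volume is small because a Gaussian density of variance [1 / n] is
    not small on it.

    The upper bound holds for all points of [D], without taking expectations.
    An invariant measure on the sphere satisfies
    [int exp(l |<x, t>|) dt <= 2 exp(l^2 / 2)] as soon as [|x|^2 <= n / 4]
    ([integral_sphere_expR_norm_dot]): a reflection turns [x] into a multiple of
    the all-ones vector, and averaging over the changes of signs of the
    coordinates of [t] produces a product of hyperbolic cosines. The maximum of
    [N] such variables has mean of order [sqrt (ln N)]
    ([integral_max_abs_dot_le]).

    For the lower bound, fix a direction [t] with [|<X_1, t>| <= 4] with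
    probability at least [1 / 2]. The map [x |-> s x +- h t], with [s] slightly
    smaller than 1, sends half of the slab [|<x, t>| <= 4] of [D] into the part
    of [D] at distance at least [h] from the hyperplane orthogonal to [t]
    ([uniform_ball_cap]). When [h] is a small multiple of [sqrt (ln N)], this
    divides the probability by at most [N], and by independence one of the
    points lies at distance at least [h] with probability bounded below
    ([integral_max_abs_dot_ge]). By the exponential moments above, the
    directions excluded so far have small measure ([integral_penalty_le]). In
    this way rotations act only on the sphere, and on Lebesgue measure one only
    needs the effect of the maps [x |-> s x + v] ([lebesgue_row_affine]). *)

Import Order.TTheory GRing.Theory Num.Theory.
Import numFieldNormedType.Exports.

Local Open Scope classical_set_scope.
Local Open Scope ring_scope.
Set Implicit Arguments.
Unset Strict Implicit.
Unset Printing Implicit Defensive.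

(** * Elementary inequalities *)

Lemma expR_le_inv (R : realType) (x : R) : x < 1 -> expR x <= (1 - x)^-1.
Proof.
move=> x1; rewrite -[expR x]invrK -expRN lef_pV2 ?posrE ?expR_gt0 ?subr_gt0 //.
exact: expR_ge1Dx.
Qed.

Lemma inv_le_expR (R : realType) (u : R) : 0 <= u -> u <= 2^-1 ->
  (1 - u)^-1 <= expR (2 * u).
Proof.
move=> u0 u1; apply: le_trans (expR_ge1Dx (2 * u)).
rewrite -[leLHS]mul1r ler_pdivrMr; nra.
Qed.

(** That is, [cosh x <= exp (2 x^2)]. For small [x] the bounds
    [exp (+- x) <= 1 / (1 -+ x)] add up to [2 / (1 - x^2)]; otherwise
    [|x| <= 2 x^2]. *)
Lemma expRD_expRN_le (R : realType) (x : R) :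
  expR x + expR (- x) <= 2 * expR (2 * x ^+ 2).
Proof.
have [x2|x2] := leP (x ^+ 2) 2^-1.
  have x1 : x < 1 by nra.
  have x1' : - x < 1 by nra.
  apply: (le_trans (lerD (expR_le_inv x1) (expR_le_inv x1'))).
  apply: (@le_trans _ _ (2 * (1 - x ^+ 2)^-1)).
    rewrite le_eqVlt; apply/orP; left; apply/eqP; field.
    by rewrite !gt_eqF //; nra.
  by rewrite ler_pM2l //; apply: inv_le_expR; rewrite ?sqr_ge0.
by rewrite mulr_natl mulr2n; apply: lerD; rewrite ler_expR; nra.
Qed.

Lemma expR_half_le2 (R : realType) : expR 2^-1 <= 2 :> R.
Proof.
have := @expR_le_inv R 2^-1; rewrite (_ : (1 - 2^-1)^-1 = 2); last by field.
by apply; lra.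
Qed.

Lemma ln_nat_ge (R : realType) N : (1 < N)%N -> 2^-1 <= ln (N%:R : R).
Proof.
move=> N1; rewrite -ler_expR lnK ?posrE ?ltr0n 1?ltnW //.
by apply: (le_trans (expR_half_le2 R)); rewrite ler_nat.
Qed.

(** * Euclidean geometry of row vectors *)

Section dot_theory.
Variables (R : realType) (n : nat).
Implicit Types x y z : 'rV[R]_n.

Lemma dotE x y : dot x y = (x *m y^T) ord0 ord0.
Proof. by rewrite /dot mxE; apply: eq_bigr => i _; rewrite mxE. Qed.

Lemma dotC x y : dot x y = dot y x.
Proof. by apply: eq_bigr => i _; rewrite mulrC. Qed.

Lemma dotDl x y z : dot (x + y) z = dot x z + dot y z.
Proof. by rewrite !dotE mulmxDl mxE. Qed.

Lemma dotZl (a : R) x y : dot (a *: x) y = a * dot x y.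
Proof. by rewrite !dotE -scalemxAl mxE. Qed.

Lemma dotNl x y : dot (- x) y = - dot x y.
Proof. by rewrite -scaleN1r dotZl mulN1r. Qed.

Lemma dotDr x y z : dot z (x + y) = dot z x + dot z y.
Proof. by rewrite !(dotC z) dotDl. Qed.

Lemma dotZr (a : R) x y : dot x (a *: y) = a * dot x y.
Proof. by rewrite !(dotC x) dotZl. Qed.

Lemma dotNr x y : dot x (- y) = - dot x y.
Proof. by rewrite !(dotC x) dotNl. Qed.

Lemma dot_mulmxr x y (Q : 'M[R]_n) : dot x (y *m Q) = dot (x *m Q^T) y.
Proof. by rewrite !dotE trmx_mul mulmxA. Qed.

Lemma dot_ge0 x : 0 <= dot x x.
Proof. by apply: sumr_ge0 => i _; rewrite -expr2 sqr_ge0. Qed.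

Lemma dot_eq0 x : dot x x = 0 -> x = 0.
Proof.
move=> x0; apply/rowP => i; rewrite mxE; apply/eqP.
suff /eqP : x ord0 i * x ord0 i = 0 by rewrite mulf_eq0 orbb.
by apply: (psumr_eq0P _ x0) => // j _; rewrite -expr2 sqr_ge0.
Qed.

(** The reflection that exchanges [u] and [v], in the hyperplane orthogonal to
    [u - v]. *)
Lemma householder u v : dot u u = dot v v ->
  exists Q : 'M[R]_n, Q *m Q^T = 1%:M /\ u *m Q = v.
Proof.
move=> uv; have [->|neq] := eqVneq u v.
  by exists 1%:M; rewrite trmx1 !mulmx1.
pose w := u - v; have w0 : dot w w != 0.
  by apply: contra neq => /eqP/dot_eq0/eqP; rewrite subr_eq0.
pose W : 'M[R]_n := w^T *m w; pose a := 2 / dot w w.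
have wW : w *m W = dot w w *: w.
  by rewrite mulmxA [w *m _]mx11_scalar mul_scalar_mx -dotE.
have WW : W *m W = dot w w *: W by rewrite -mulmxA wW -scalemxAr.
have WT : W^T = W by rewrite trmx_mul trmxK.
exists (1%:M - a *: W); split.
  rewrite [X in _ *m X]linearB /= trmx1 [(a *: W)^T]linearZ /= WT.
  rewrite mulmxBl mul1mx mulmxBr mulmx1.
  rewrite -!scalemxAl -scalemxAr WW !scalerA.
  rewrite (_ : a * a * dot w w = a + a); last by rewrite /a; field.
  rewrite scalerDl [X in _ - X = _](_ : _ = - (a *: W)) ?opprK ?subrK //.
  by rewrite opprD addrA subrr sub0r.
have uw : 2 * dot u w = dot w w.
  rewrite /w dotDr dotNr !dotDl dotDr dotNr !dotNl !dotDr !dotNr -uv (dotC v u).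
  by ring.
rewrite mulmxBr mulmx1 -scalemxAr mulmxA.
rewrite [u *m _]mx11_scalar mul_scalar_mx -dotE.
by rewrite scalerA (_ : a * _ = 1) ?scale1r ?subKr // /a mulrAC uw divff.
Qed.

End dot_theory.

Lemma measurable_dot (R : realType) n d (T : measurableType d)
    (f g : T -> 'rV[R]_n) : measurable_fun setT f -> measurable_fun setT g ->
  measurable_fun setT (fun x => dot (f x) (g x)).
Proof.
move=> mf mg; apply: measurable_sum => i.
by apply: measurable_funM; [exact: (measurable_fun_rowP _).1 mf i|
                            exact: (measurable_fun_rowP _).1 mg i].
Qed.

Lemma measurable_dot_le (R : realType) n (c : R) :
  measurable [set x : 'rV[R]_n | dot x x <= c].
Proof.
have := @measurable_dot R n _ _ id id (@measurable_id _ _ _)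
  (@measurable_id _ _ _).
move=> /(_ measurableT _ (measurable_itv `]-oo, c])); rewrite setTI.
by congr measurable; apply/seteqP; split => x /=; rewrite in_itv.
Qed.

Lemma measurable_dot_preimage (R : realType) n (t : 'rV[R]_n) (A : set R) :
  measurable A -> measurable [set x : 'rV[R]_n | A (dot x t)].
Proof.
move=> mA; rewrite -[X in measurable X]setTI.
by apply: (measurable_dot _ _) => //; exact: measurable_cst.
Qed.

Lemma measurable_slab (R : realType) n (t : 'rV[R]_n) (c : R) :
  measurable [set x : 'rV[R]_n | `|dot x t| <= c].
Proof.
apply: (measurable_dot_preimage t (A := [set y | `|y| <= c])).
have := @normr_measurable R setT measurableT _ (measurable_itv `]-oo, c]).
by rewrite setTI; congr measurable; apply/funext => y /=; rewrite in_itv.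
Qed.

Lemma measurable_caps (R : realType) n (t : 'rV[R]_n) (c : R) :
  measurable [set x : 'rV[R]_n | c <= `|dot x t|].
Proof.
apply: (measurable_dot_preimage t (A := [set y | c <= `|y|])).
have := @normr_measurable R setT measurableT _ (measurable_itv `[c, +oo[).
rewrite setTI; congr measurable; apply/funext => y /=.
by rewrite in_itv /= andbT.
Qed.

Lemma euclidean_ballE (R : realType) n :
  @euclidean_ball R n = [set x | dot x x <= 1].
Proof.
rewrite /euclidean_ball /euclidean_norm; apply/funext => x /=.
by rewrite -[X in Num.sqrt _ <= X]sqrtr1 ler_sqrt.
Qed.

Lemma measurable_euclidean_ball (R : realType) n :
  measurable (@euclidean_ball R n).
Proof. by rewrite euclidean_ballE; exact: measurable_dot_le. Qed.

Lemma euclidean_sphereE (R : realType) n :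
  @euclidean_sphere R n = [set x | dot x x = 1].
Proof.
rewrite /euclidean_sphere /euclidean_norm; apply/funext => x /=.
apply/propext; split => [|->]; last by rewrite sqrtr1.
by move=> /(congr1 (fun u => u ^+ 2)); rewrite sqr_sqrtr ?dot_ge0 // expr1n.
Qed.

Lemma measurable_euclidean_sphere (R : realType) n :
  measurable (@euclidean_sphere R n).
Proof.
rewrite euclidean_sphereE.
have := @measurable_dot R n _ _ id id (@measurable_id _ _ _)
  (@measurable_id _ _ _).
by move=> /(_ measurableT _ (measurable_set1 1)); rewrite setTI.
Qed.

(** * Lebesgue measure under affine maps *)

Lemma lebesgue_measure_affine (R : realType) (s b : R) (A : set R) :
  0 < s -> measurable A ->
  lebesgue_measure A =
  (s%:E * lebesgue_measure [set a : R | A (s * a + b)%R])%E.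
Proof.
move=> s0 mA.
pose f := fun a : measurableTypeR R => (s * a + b) : measurableTypeR R.
have mf : measurable_fun setT f.
  by apply: measurable_funD => //; exact: measurable_funM.
pose m := mscale (NngNum (ltW s0)) (pushforward (@lebesgue_measure R) f).
rewrite -[RHS]/(m mf A).
apply: (@lebesgue_measure_unique R (m mf)) => //= _ [[a c]] _ <- /=.
have fac : f @^-1` `]a, c]%classic = `](a - b) / s, (c - b) / s]%classic.
  by apply/seteqP; split => x /=;
    rewrite !in_itv/= ltr_pdivrMr // ler_pdivlMr // /f; lra.
rewrite [RHS]/(s%:E * lebesgue_measure (f @^-1` `]a, c]))%E fac.
rewrite !lebesgue_measure_itv/= !lte_fin ltr_pM2r ?invr_gt0// ltrD2r.
case: ifPn => _ /=; last by rewrite mulr0.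
by congr EFin; field; rewrite gt_eqF.
Qed.

Lemma ge0_integral_affine (R : realType) (s b : R) (g : R -> \bar R) :
  0 < s -> measurable_fun setT g -> (forall x, 0 <= g x)%E ->
  (\int[lebesgue_measure]_x g x =
   s%:E * \int[lebesgue_measure]_x g (s * x + b)%R)%E.
Proof.
move=> s0 mg g0.
pose f := fun a : measurableTypeR R => (s * a + b) : measurableTypeR R.
have mf : measurable_fun setT f.
  by apply: measurable_funD => //; exact: measurable_funM.
rewrite -[X in (_ * X)%E]/(\int[lebesgue_measure]_(x in f @^-1` setT)
  (g \o f) x)%E.
rewrite -ge0_integral_pushforward//.
rewrite -(ge0_integral_mscale _ _ (NngNum (ltW s0)))//.
apply: eq_measure_integral => A mA _.
by rewrite /= (lebesgue_measure_affine b s0 mA).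
Qed.

Lemma measurable_row_affine (R : realType) n (s : R) (v : 'rV[R]_n) :
  measurable_fun setT (fun x : 'rV[R]_n => s *: x + v).
Proof.
apply/measurable_fun_rowP => i; under eq_fun do rewrite !mxE.
apply: measurable_funD => //; apply: measurable_funM => //.
exact: measurable_coord.
Qed.

(** By induction on the dimension: the sections of the preimage of [A] are the
    preimages of the sections of [A], along the affine map of one dimension
    less. *)
Lemma lebesgue_row_affine (R : realType) n (s : R) (v : 'rV[R]_n)
    (A : set 'rV[R]_n) : 0 < s -> measurable A ->
  lebesgue_row R n A =
  ((s ^+ n)%:E * lebesgue_row R n [set x | A (s *: x + v)%R])%E.
Proof.
move=> s0; elim: n v A => [|n IHn] v A mA.
  rewrite expr0 mul1e /=; congr (dirac _ _).
  by apply/funext => x /=; congr A; by apply/rowP => -[].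
have mc (B : set 'rV[R]_n.+1) : measurable B ->
    measurable (@row_cons R n @^-1` B).
  by move=> mB; rewrite -[X in measurable X]setTI; exact: measurable_row_cons.
pose w : 'rV[R]_n := \row_j v ord0 (lift ord0 j).
pose B : set 'rV[R]_n.+1 := [set x | A (s *: x + v)].
have mB : measurable B.
  by rewrite -[B]setTI; exact: measurable_row_affine.
rewrite -/B /= /lebesgue_cons /pushforward /= /product_measure1 /=.
have xB a : xsection (@row_cons R n @^-1` B) a =
    [set y | xsection (@row_cons R n @^-1` A) (s * a + v ord0 ord0)
      (s *: y + w)].
  apply/seteqP; split => y /=; rewrite /xsection /= !inE /B /=;
  (have -> : row_cons (s * a + v ord0 ord0, s *: y + w) =
     s *: row_cons (a, y) + v;
   [apply/rowP => i; rewrite row_consE [RHS]mxE [X in _ = X + _]mxE row_consE;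
     case: unliftP => [j|] -> /=; by rewrite ?mxE|by []]).
rewrite (ge0_integral_affine (v ord0 ord0) s0); first last.
- by move=> x.
- by apply: measurable_fun_xsection; exact: mc.
rewrite exprS EFinM -muleA; congr (_ * _)%E.
rewrite -ge0_integralZl //.
- apply: eq_integral => a _ /=; rewrite xB -IHn //.
  by apply: measurable_xsection; exact: mc.
- by apply: measurable_fun_xsection; exact: mc.
- by rewrite lee_fin exprn_ge0 // ltW.
Qed.

(** * The radius of the ball of volume one *)

Lemma integral_lebesgue_row_prod (R : realType) n (f : R -> R) (c : R) :
  measurable_fun setT f -> (forall x, 0 <= f x) ->
  (\int[lebesgue_measure]_x (f x)%:E = c%:E)%E ->
  (\int[lebesgue_row R n]_x (\prod_(i < n) f (x ord0 i))%:E = (c ^+ n)%:E)%E.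
Proof.
move=> mf f0 fc; elim: n => [|n IHn].
  under eq_integral do rewrite big_ord0.
  by rewrite integral_cst //= diracT mule1 expr0.
have mp k : measurable_fun setT
    (fun x : 'rV[R]_k => \prod_(i < k) f (x ord0 i)).
  apply: measurable_prod => i _; apply: measurableT_comp => //.
  exact: measurable_coord.
pose prod := [the {measure set (measurableTypeR R * 'rV[R]_n)%type -> \bar R}
  of (lebesgue_measure \x lebesgue_row R n)%E].
have mrc : measurable_fun [set: (measurableTypeR R * 'rV[R]_n)%type]
  (@row_cons R n) := @measurable_row_cons R n.
rewrite [LHS](ge0_integral_pushforward mrc prod) //;
  first last.
- by move=> y _; rewrite lee_fin; exact: prodr_ge0.
- by apply/measurable_EFinP; exact: mp.
rewrite preimage_setT fubini_tonelli1 //; first last.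
- by move=> y; rewrite lee_fin; exact: prodr_ge0.
- apply/measurable_EFinP; apply: measurableT_comp (mp _) _.
  exact: measurable_row_cons.
under eq_integral => a _.
  rewrite /fubini_F /=.
  under eq_integral => y _.
    rewrite big_ord_recl row_consE unlift_none /= EFinM.
    under eq_bigr do rewrite row_consE liftK /=.
    over.
  rewrite ge0_integralZl //; first last.
  - by rewrite lee_fin.
  - by move=> y _; rewrite lee_fin; exact: prodr_ge0.
  - by apply/measurable_EFinP; exact: mp.
  rewrite IHn.
  over.
rewrite ge0_integralZr //; first last.
- by rewrite lee_fin exprn_ge0 // -lee_fin -fc; apply: integral_ge0 => x _;
  rewrite lee_fin.
- by move=> y _; rewrite lee_fin.
- by apply/measurable_EFinP.
- by rewrite fc exprS EFinM.
Qed.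

(** The cube of half side [1 / sqrt n] is contained in the ball. *)
Lemma lebesgue_row_ball_ge (R : realType) n : (0 < n)%N ->
  (((2 / Num.sqrt n%:R) ^+ n)%:E <= lebesgue_row R n (@euclidean_ball R n))%E.
Proof.
move=> n0; have sn0 : 0 < Num.sqrt n%:R :> R by rewrite sqrtr_gt0 ltr0n.
pose I := `[- (Num.sqrt n%:R)^-1, (Num.sqrt n%:R)^-1]%classic : set R.
have := @lebesgue_row_box R n (fun=> I) (fun=> measurable_itv _).
rewrite lebesgue_measure_itv /= lte_fin ifT; last first.
  by rewrite gtrN // invr_gt0.
rewrite opprK -EFinD prodEFin prodr_const card_ord.
rewrite (_ : _ + _ = 2 / Num.sqrt n%:R) => [<-|]; last by ring.
apply: le_measure; rewrite ?inE.
- rewrite (_ : (fun x => _) =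
      \bigcap_i ((fun x : 'rV[R]_n => x ord0 i) @^-1` I)); last first.
    by apply/seteqP; split=> x /= h i; [move=> _; exact: h|exact: h].
  apply: fin_bigcap_measurable => // i _.
  rewrite -[X in measurable X]setTI; apply: measurable_coord => //.
  exact: measurable_itv.
- by rewrite euclidean_ballE; exact: measurable_dot_le.
rewrite euclidean_ballE => x /= xI; rewrite /dot.
apply: (@le_trans _ _ (\sum_(i < n) n%:R^-1)); last first.
  by rewrite sumr_const card_ord -[_ *+ n]mulr_natl divff // pnatr_eq0 -lt0n.
apply: ler_sum => i _; have := xI i; rewrite /I /= in_itv /= => /andP[h1 h2].
rewrite -expr2 -real_normK ?num_real // -[leRHS]sqr_sqrtr ?invr_ge0 //.
rewrite ler_sqr ?nnegrE ?sqrtr_ge0 // sqrtrV // ler_norml h2 andbT //.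
Qed.

(** The [n]-th power of this constant bounds the volume of the ball of radius
    [sqrt n]. *)
Definition ball_const (R : realType) : R := expR 1 * Num.sqrt (pi *+ 2).

Lemma ball_const_ge1 (R : realType) : 1 <= ball_const R.
Proof.
have e1 : 1 <= expR 1 :> R by apply: le_trans (expR_ge1Dx 1); lra.
have s1 : 1 <= Num.sqrt (pi *+ 2) :> R.
  rewrite -[leLHS]sqrtr1 ler_wsqrtr //.
  by have := pi_ge2 R; rewrite -[pi *+ 2]mulr_natl; lra.
by rewrite /ball_const -[leLHS]mul1r ler_pM.
Qed.

(** The Gaussian density with independent coordinates of variance [1 / n] is at
    least [normal_peak ^+ n * exp (- n)] on the unit ball, and its integral is
    1. *)
Lemma lebesgue_row_ball_le (R : realType) n : (0 < n)%N ->
  (lebesgue_row R n (@euclidean_ball R n) <=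
   ((ball_const R / Num.sqrt n%:R) ^+ n)%:E)%E.
Proof.
move=> n0; have sn0 : 0 < Num.sqrt n%:R :> R by rewrite sqrtr_gt0 ltr0n.
pose s : R := (Num.sqrt n%:R)^-1.
have s0 : s != 0 by rewrite invr_eq0 gt_eqF.
have s2 : s ^+ 2 = n%:R^-1 by rewrite exprVn sqr_sqrtr ?ler0n.
pose k : R := expR (- 1) * normal_peak s.
have k0 : 0 < k by rewrite mulr_gt0 ?expR_gt0 ?normal_peak_gt0.
have kE : k = (ball_const R / Num.sqrt n%:R)^-1.
  rewrite /k /ball_const /normal_peak expRN -!invfM; congr (_^-1).
  rewrite -mulrA; congr (_ * _).
  rewrite (_ : s ^+ 2 * pi *+ 2 = s ^+ 2 * (pi *+ 2)); last by ring.
  rewrite sqrtrM ?sqr_ge0 ?sqrtr_sqr; last by [].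
  by rewrite ger0_norm 1?mulrC // invr_ge0 sqrtr_ge0.
have mB := @measurable_euclidean_ball R n.
have mp : measurable_fun setT
    (fun x : 'rV[R]_n => \prod_(i < n) normal_pdf 0 s (x ord0 i)).
  apply: measurable_prod => i _; apply: measurableT_comp.
    exact: measurable_normal_pdf.
  exact: measurable_coord.
have p0 (x : 'rV[R]_n) : (0 <= (\prod_(i < n) normal_pdf 0 s (x ord0 i))%:E)%E.
  by rewrite lee_fin; apply: prodr_ge0 => i _; exact: normal_pdf_ge0.
have kB : ((k ^+ n)%:E * lebesgue_row R n (@euclidean_ball R n) <= 1)%E.
  rewrite -integral_cst //.
  have <- : (\int[lebesgue_row R n]_x
      (\prod_(i < n) normal_pdf 0 s (x ord0 i))%:E = 1)%E.
    rewrite (@integral_lebesgue_row_prod R n _ 1) ?expr1n //.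
    - exact: measurable_normal_pdf.
    - exact: normal_pdf_ge0.
    - exact: integral_normal_pdf.
  apply: (@le_trans _ _ (\int[lebesgue_row R n]_(x in @euclidean_ball R n)
      (\prod_(i < n) normal_pdf 0 s (x ord0 i))%:E)%E); last first.
    apply: ge0_subset_integral => //; exact/measurable_EFinP.
  apply: ge0_le_integral => //.
  - by move=> x _; rewrite lee_fin exprn_ge0 // ltW.
  - by apply: measurable_funTS; exact/measurable_EFinP.
  rewrite euclidean_ballE => x /= x1; rewrite lee_fin normal_pdfE //.
  rewrite big_split /= prodr_const card_ord mulrC exprMn ler_pM2r; last first.
    by rewrite exprn_gt0 // normal_peak_gt0.
  rewrite /normal_fun -expR_sum -expRM_natl ler_expR mulrN1.
  rewrite (_ : \sum_(i < n) _ = - (dot x x) * (n%:R / 2)); last first.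
    rewrite /dot mulNr mulr_suml -sumrN; apply: eq_bigr => i _.
    rewrite subr0 s2; field; rewrite pnatr_eq0 -lt0n n0 //.
  have : 0 < n%:R :> R by rewrite ltr0n.
  by nra.
have kn0 : 0 < k ^+ n by rewrite exprn_gt0.
rewrite -(invrK (ball_const R / _)) -kE exprVn.
rewrite -[leLHS]mul1e -[1%E]/(1%:E) -(mulVf (lt0r_neq0 kn0)) EFinM -muleA.
rewrite -[leRHS]mule1; apply: lee_wpmul2l; last exact: kB.
by rewrite lee_fin invr_ge0 ltW.
Qed.

(** The radius is the inverse of the [n]-th root of the volume of the unit ball,
    of which the two previous bounds are [n]-th powers. *)
Lemma unit_volume_ballE (R : realType) n : (0 < n)%N -> exists r : R,
  [/\ 0 < r, n%:R / ball_const R ^+ 2 <= r ^+ 2, r ^+ 2 <= n%:R / 4 &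
      @unit_volume_ball R n = [set x | dot x x <= r ^+ 2]].
Proof.
move=> n0; have sn0 : 0 < Num.sqrt n%:R :> R by rewrite sqrtr_gt0 ltr0n.
have nn0 : n%:R != 0 :> R by rewrite pnatr_eq0 -lt0n.
have C0 : 0 < ball_const R.
  by rewrite mulr_gt0 ?expR_gt0 // sqrtr_gt0 mulrn_wgt0 // pi_gt0.
have := lebesgue_row_ball_ge R n0; have := lebesgue_row_ball_le R n0.
pose V := volume (@euclidean_ball R n).
move=> le1 le2.
have fV : lebesgue_row R n (@euclidean_ball R n) = V%:E.
  rewrite /V /volume fineK // ge0_fin_numE; last exact: measure_ge0.
  by apply: le_lt_trans le1 _; rewrite ltry.
rewrite fV lee_fin in le1; rewrite fV lee_fin in le2.
pose rho := V `^ n%:R^-1.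
have root (a : R) : 0 <= a -> (a ^+ n) `^ n%:R^-1 = a.
  by move=> a0; rewrite -powR_mulrn // -powRrM divff // powRr1.
have q1 : 0 < 2 / Num.sqrt n%:R :> R by rewrite divr_gt0.
have q2 : 0 < ball_const R / Num.sqrt n%:R by rewrite divr_gt0.
have V0 : 0 <= V by apply: (le_trans _ le2); rewrite exprn_ge0 // ltW.
have rho1 : 2 / Num.sqrt n%:R <= rho.
  rewrite -[leLHS]root; last exact: ltW.
  by rewrite ge0_ler_powR ?invr_ge0 ?nnegrE // exprn_ge0 // ltW.
have rho2 : rho <= ball_const R / Num.sqrt n%:R.
  rewrite -[leRHS]root; last exact: ltW.
  by rewrite ge0_ler_powR ?invr_ge0 ?nnegrE // exprn_ge0 // ltW.
have rho0 : 0 < rho by apply: (lt_le_trans _ rho1); rewrite divr_gt0.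
exists rho^-1; split.
- by rewrite invr_gt0.
- rewrite -[leLHS]invrK exprVn lef_pV2 ?posrE ?exprn_gt0 //; last first.
    by rewrite invr_gt0 divr_gt0 ?ltr0n // exprn_gt0.
  rewrite invf_div -[X in _ / X]sqr_sqrtr // -expr_div_n.
  by rewrite ler_sqr // ?nnegrE ?ltW.
- rewrite -[leRHS]invrK exprVn lef_pV2 ?posrE ?exprn_gt0 //; last first.
    by rewrite invr_gt0 divr_gt0 ?ltr0n.
  rewrite invf_div -[X in _ / X]sqr_sqrtr // (_ : 4 = 2 ^+ 2); last by ring.
  by rewrite -expr_div_n ler_sqr // ?nnegrE ?ltW //.
have dotZ (a : R) (x : 'rV[R]_n) : dot (a *: x) (a *: x) = a ^+ 2 * dot x x.
  by rewrite dotZl dotZr mulrA.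
rewrite /unit_volume_ball -/V -/rho euclidean_ballE.
apply/seteqP; split => x /=.
  move=> [y y1 <-]; rewrite dotZ -[leRHS]mulr1 ler_pM2l //.
  by rewrite exprn_gt0 // invr_gt0.
move=> xr; exists (rho *: x); last by rewrite scalerA mulVf ?scale1r ?gt_eqF.
by rewrite dotZ -ler_pdivlMl ?exprn_gt0 // mulr1 -exprVn.
Qed.

(** * Exponential moments of linear functionals on the sphere *)

Section uniform_sphere.
Context (R : realType) (n : nat) (mu : probability 'rV[R]_n R).
Hypothesis mu_unif : uniform_on_sphere mu.
Notation S := (@euclidean_sphere R n).

Lemma measurable_mulmxr (Q : 'M[R]_n) :
  measurable_fun setT (mulmxr Q : 'rV[R]_n -> 'rV[R]_n).
Proof.
apply/measurable_fun_rowP => i; under eq_fun do rewrite mxE.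
apply: measurable_sum => j; apply: measurable_funM => //.
exact: measurable_coord.
Qed.

Lemma integral_sphere_mulmx (Q : 'M[R]_n) (g : 'rV[R]_n -> R) :
  Q *m Q^T = 1%:M -> measurable_fun setT g -> (forall x, 0 <= g x) ->
  (\int[mu]_(x in S) (g x)%:E = \int[mu]_(x in S) (g (x *m Q))%:E)%E.
Proof.
move=> QQ mg g0; have [_ muQ] := mu_unif.
rewrite [in RHS](_ : S = mulmxr Q @^-1` S); last first.
  rewrite euclidean_sphereE; apply/funext => x /=.
  by rewrite dot_mulmxr -mulmxA QQ mulmx1.
have mS := @measurable_euclidean_sphere R n.
have := @ge0_integral_pushforward _ _ _ _ R _ (measurable_mulmxr Q) mu S
  (EFin \o g) mS.
rewrite /comp /= => <-.
- apply: eq_measure_integral => [|mQ A mA _]; first exact: measurable_mulmxr.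
  exact/esym/(muQ Q QQ).
- by apply: measurable_funTS; apply/measurable_EFinP.
- by move=> x _; rewrite lee_fin.
Qed.

(** The integral does not change if the signs of the coordinates of [t] are
    flipped. The average of the integrands over all signs is the product of the
    [cosh (c t_i)], at most [exp (2 c^2 |t|^2)]. *)
Lemma integral_sphere_expR_ones (c : R) :
  (\int[mu]_(x in S) (expR (\sum_(i < n) c * x ord0 i))%:E
    <= (expR (2 * c ^+ 2))%:E)%E.
Proof.
have mS := @measurable_euclidean_sphere R n.
pose E (e : {ffun 'I_n -> bool}) (x : 'rV[R]_n) : R :=
  \prod_(i < n) expR (c * ((-1) ^+ e i * x ord0 i)).
have E0 e x : 0 <= E e x by apply: prodr_ge0 => i _; exact: expR_ge0.
have mE e : measurable_fun setT (E e).
  apply: measurable_prod => i _; apply: measurableT_comp => //.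
  by do 2 (apply: measurable_funM => //); exact: measurable_coord.
have sign e : (\int[mu]_(x in S) (expR (\sum_(i < n) c * x ord0 i))%:E =
    \int[mu]_(x in S) (E e x)%:E)%E.
  pose Q : 'M[R]_n := diag_mx (\row_i (-1) ^+ e i).
  rewrite (@integral_sphere_mulmx Q).
  - apply: eq_integral => x _; congr EFin; rewrite expR_sum.
    apply: eq_bigr => i _.
    by rewrite mul_mx_diag !mxE [(-1) ^+ _ * _]mulrC.
  - rewrite /Q tr_diag_mx mulmx_diag; apply/matrixP => i j; rewrite !mxE.
    by rewrite -expr2 sqrr_sign.
  - apply: measurableT_comp => //; apply: measurable_sum => i.
    by apply: measurable_funM => //; exact: measurable_coord.
  - by move=> x; exact: expR_ge0.
set I := (\int[mu]_(x in S) _)%E in sign *.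
have mES e : measurable_fun S (EFin \o E e).
  by apply: measurable_funTS; apply/measurable_EFinP.
have sumE : ((2 ^+ n)%:E * I = \int[mu]_(x in S) (\sum_e E e x)%:E)%E.
  under eq_integral do rewrite -sumEFin.
  rewrite ge0_integral_sum //; last by move=> e x _; rewrite lee_fin.
  rewrite (eq_bigr (fun=> I)); last by move=> e _; rewrite -sign.
  rewrite sumr_const card_ffun card_bool card_ord.
  by rewrite -[in LHS]natrX; exact: mule_natl.
have le2 : ((2 ^+ n)%:E * I <= (2 ^+ n)%:E * (expR (2 * c ^+ 2))%:E)%E.
  rewrite -EFinM -[leRHS]mule1 -[X in (_ <= _ * X)%E](mu_unif.1).
  rewrite -integral_cst // sumE; apply: ge0_le_integral => //.
  - by move=> x _; rewrite lee_fin sumr_ge0.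
  - apply: measurable_funTS; apply/measurable_EFinP.
    exact: measurable_sum.
  rewrite euclidean_sphereE => x /= x1; rewrite lee_fin.
  rewrite -(bigA_distr_bigA
    (fun i b => expR (c * ((-1) ^+ (b : bool) * x ord0 i)))).
  apply: (@le_trans _ _ (\prod_(i < n) (2 * expR (2 * (c * x ord0 i) ^+ 2)))).
    apply: ler_prod => i _; rewrite big_bool /= expr0 expr1 mul1r mulN1r mulrN.
    by rewrite addr_ge0 ?expR_ge0 //= addrC expRD_expRN_le.
  rewrite big_split /= prodr_const card_ord -expR_sum ler_pM2l ?exprn_gt0 //.
  rewrite ler_expR -[leRHS]mulr1 -x1 /dot mulr_sumr ler_sum // => i _.
  by rewrite exprMn expr2; lra.
by move: le2; rewrite lee_pmul2l // lte_fin exprn_gt0.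
Qed.

(** A reflection maps [x] to the multiple of the all-ones vector that has the
    same norm. *)
Lemma integral_sphere_expR_dot (x : 'rV[R]_n) : (0 < n)%N ->
  (\int[mu]_(t in S) (expR (dot x t))%:E
    <= (expR (2 * (dot x x / n%:R)))%:E)%E.
Proof.
move=> n0; pose c := Num.sqrt (dot x x / n%:R).
have cE : c ^+ 2 = dot x x / n%:R by rewrite sqr_sqrtr // divr_ge0 ?dot_ge0.
have nn0 : n%:R != 0 :> R by rewrite pnatr_eq0 -lt0n.
have [|Q [QQ xQ]] := @householder R n x (const_mx c).
  rewrite {2}/dot; under [RHS]eq_bigr do rewrite !mxE.
  by rewrite sumr_const card_ord -[_ *+ n]mulr_natl -expr2 cE mulrC divfK.
have QQ' : Q^T *m Q^T^T = 1%:M by rewrite trmxK; exact: mulmx1C.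
(* The transpose of Q acts on t, so that Q acts on x. *)
rewrite (integral_sphere_mulmx QQ'); last 2 first.
- apply: measurableT_comp => //.
  by apply: measurable_dot => //; exact: measurable_cst.
- by move=> t; exact: expR_ge0.
rewrite -cE; apply: le_trans (integral_sphere_expR_ones c).
rewrite le_eqVlt; apply/orP; left; apply/eqP; apply: eq_integral => t _.
rewrite dot_mulmxr trmxK xQ /dot; congr (expR _)%:E.
by apply: eq_bigr => i _; rewrite mxE.
Qed.

Lemma integral_sphere_expR_norm_dot (x : 'rV[R]_n) (l : R) : (0 < n)%N ->
  dot x x <= n%:R / 4 ->
  (\int[mu]_(t in S) (expR (l * `|dot x t|))%:E
    <= (2 * expR (l ^+ 2 / 2))%:E)%E.
Proof.
move=> n0 xn; have mS := @measurable_euclidean_sphere R n.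
have md y : measurable_fun S (fun t => (expR (dot y t))%:E).
  apply: measurable_funTS; apply/measurable_EFinP.
  apply: measurableT_comp => //.
  by apply: measurable_dot => //; exact: measurable_cst.
have bound a : a ^+ 2 = l ^+ 2 ->
    (\int[mu]_(t in S) (expR (dot (a *: x) t))%:E <= (expR (l ^+ 2 / 2))%:E)%E.
  move=> al; apply: (le_trans (integral_sphere_expR_dot _ n0)).
  rewrite lee_fin ler_expR dotZl dotZr !mulrA -[2 * a * a]mulrA -expr2 al.
  have nn0 : 0 < n%:R :> R by rewrite ltr0n.
  have : dot x x / n%:R <= 4^-1 by rewrite ler_pdivrMr // mulrC.
  have := sqr_ge0 l; rewrite -[2 * l ^+ 2 * _ / _]mulrA; nra.
apply: (@le_trans _ _ (\int[mu]_(t in S)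
    ((expR (dot (l *: x) t))%:E + (expR (dot (- l *: x) t))%:E))%E).
  apply: ge0_le_integral => //.
  - apply: measurable_funTS; apply/measurable_EFinP.
    apply: measurableT_comp => //.
    apply: measurable_funM => //; apply: measurableT_comp => //.
    by apply: measurable_dot => //; exact: measurable_cst.
  - by apply: emeasurable_funD.
  move=> t _; rewrite -EFinD lee_fin !dotZl mulNr.
  by case: (ger0P (dot x t)) => _; rewrite ?mulrN (lerDl, lerDr) expR_ge0.
rewrite ge0_integralD // mulr_natl mulr2n EFinD.
by apply: leeD; apply: bound; rewrite // sqrrN.
Qed.

End uniform_sphere.

(** * The support function of a symmetric random polytope *)

Definition max_abs_dot (R : realType) n N (x : 'I_N -> 'rV[R]_n)
    (t : 'rV[R]_n) : R :=
  \big[Num.max/0]_(i < N) `|dot (x i) t|.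

Section polytope.
Context (R : realType) (n N : nat).
Implicit Types (x : 'I_N -> 'rV[R]_n) (t : 'rV[R]_n).

Lemma max_abs_dot_ge0 x t : 0 <= max_abs_dot x t.
Proof. exact: bigmax_ge_id. Qed.

Lemma abs_dot_le_max x t i : `|dot (x i) t| <= max_abs_dot x t.
Proof. exact: le_bigmax. Qed.

Lemma support_function_random_polytope x t : (0 < N)%N ->
  support_function (random_polytope x) t = max_abs_dot x t.
Proof.
move=> N0; set K := random_polytope x; set M := max_abs_dot x t.
have ub : ubound [set dot y t | y in K] M.
  move=> _ [y Ky <-].
  apply: (Ky [set z | dot z t <= M]); split.
    move=> a b l; rewrite !inE /= => aM bM.
    rewrite [X in dot X](_ : _ = l%:num *: a + (1 - l%:num) *: b) //.
    rewrite dotDl !dotZl.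
    have := ge0 l; have := le1 l; move=> /= l1 l0.
    rewrite [leRHS](_ : _ = l%:num * M + (1 - l%:num) * M); last by ring.
    by apply: lerD; rewrite ler_wpM2l // subr_ge0.
  move=> z [] /= [i _ <-]; apply: le_trans (abs_dot_le_max x t i).
    exact: ler_norm.
  by rewrite dotNl -normrN ler_norm.
have hull y : range x y \/ range (fun i => - x i) y ->
    dot y t <= sup [set dot y t | y in K].
  move=> xy; apply: ub_le_sup; first by exists M.
  by exists y => //; apply: sub_gen_smallest.
have le i : `|dot (x i) t| <= sup [set dot y t | y in K].
  by rewrite ler_norml lerNl -dotNl !hull //; [left; exists i|right; exists i].
apply/eqP; rewrite eq_le /support_function; apply/andP; split.
  apply: ge_sup => //; exists (dot (x (Ordinal N0)) t).
  exists (x (Ordinal N0)) => //.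
  by apply: sub_gen_smallest; left; exists (Ordinal N0).
apply/bigmax_leP; split => //.
exact: le_trans (le (Ordinal N0)).
Qed.

Lemma measurable_max_abs_dot d (T : measurableType d)
    (x : T -> 'I_N -> 'rV[R]_n) (t : T -> 'rV[R]_n) :
  (forall i, measurable_fun setT (x ^~ i)) -> measurable_fun setT t ->
  measurable_fun setT (fun w => max_abs_dot (x w) (t w)).
Proof.
move=> mx mt; rewrite /max_abs_dot; elim: (index_enum _) => [|i s IHs].
  by under eq_fun do rewrite big_nil; exact: measurable_cst.
under eq_fun do rewrite big_cons; apply: measurable_maxr => //.
by apply: measurableT_comp => //; exact: measurable_dot.
Qed.

Lemma max_abs_dot_sphere_le x t : dot t t = 1 ->
  max_abs_dot x t <= \sum_(i < N) \sum_(j < n) `|x i ord0 j|.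
Proof.
move=> t1; apply/bigmax_leP; split => [|i _].
  by do 2 (apply: sumr_ge0 => ? _).
rewrite (bigD1 i) //= -[leLHS]addr0 lerD ?sumr_ge0 // => [|j _]; last first.
  by apply: sumr_ge0.
apply: (le_trans (ler_norm_sum _ _ _)); apply: ler_sum => j _.
rewrite normrM ler_piMr // -(@expr_le1 _ 2) // real_normK ?num_real //.
rewrite -t1 /dot (bigD1 j) //= expr2 lerDl sumr_ge0 // => k _.
by rewrite -expr2 sqr_ge0.
Qed.

End polytope.

(** * The upper bound *)

Section width.
Context (R : realType) (n N : nat) (mu : probability 'rV[R]_n R).
Hypothesis mu_unif : uniform_on_sphere mu.
Notation S := (@euclidean_sphere R n).
Implicit Type x : 'I_N -> 'rV[R]_n.

(** Without this, a mean width equal to 0 could mean that the integral of the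
    support function is infinite. *)
Lemma integral_max_abs_dot_lty x :
  (\int[mu]_(t in S) (max_abs_dot x t)%:E < +oo)%E.
Proof.
have mS := @measurable_euclidean_sphere R n.
set c := \sum_(i < N) \sum_(j < n) `|x i ord0 j|.
apply: (@le_lt_trans _ _ (\int[mu]_(t in S) (cst c%:E t))%E).
  apply: ge0_le_integral => //.
  - by move=> t _; rewrite lee_fin max_abs_dot_ge0.
  - apply: measurable_funTS; apply/measurable_EFinP.
    by apply: measurable_max_abs_dot => // i; exact: measurable_cst.
  - move=> t; rewrite euclidean_sphereE /= => t1.
    by rewrite lee_fin max_abs_dot_sphere_le.
by rewrite integral_cst //= (mu_unif.1) mule1 ltry.
Qed.

Lemma mean_widthE x : (0 < N)%N ->
  (mean_width mu (random_polytope x))%:E =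
  (\int[mu]_(t in S) (max_abs_dot x t)%:E)%E.
Proof.
move=> N0; rewrite /mean_width /Rintegral.
under eq_integral do rewrite support_function_random_polytope //.
rewrite fineK // ge0_fin_numE; first exact: integral_max_abs_dot_lty.
by apply: integral_ge0 => t _; rewrite lee_fin max_abs_dot_ge0.
Qed.

(** For all [l > 0] and [m] one has [y <= m + exp (l (y - m)) / l], and the
    exponential of a maximum is at most the sum of the exponentials. The choice
    [l = sqrt (ln N)], [m = 3 l / 2] balances [N exp (l^2 / 2)] against
    [exp (l m)], and leaves [m + 2 / l]. *)
Lemma integral_max_abs_dot_le x : (0 < n)%N -> (1 < N)%N ->
  (forall i, dot (x i) (x i) <= n%:R / 4) ->
  (\int[mu]_(t in S) (max_abs_dot x t)%:E <=
   (11 / 2 * Num.sqrt (ln N%:R))%:E)%E.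
Proof.
move=> n0 N1 xn; have N0 : (0 < N)%N := ltnW N1.
have mS := @measurable_euclidean_sphere R n.
have L2 := @ln_nat_ge R N N1; set L := ln N%:R in L2 *.
pose l := Num.sqrt L; have l0 : 0 < l by rewrite sqrtr_gt0; lra.
have lL : l ^+ 2 = L by rewrite sqr_sqrtr //; lra.
pose m := 3 / 2 * l.
pose g (i : 'I_N) t := expR (l * `|dot (x i) t|).
have mg i : measurable_fun setT (g i).
  apply: measurableT_comp => //; apply: measurable_funM => //.
  by apply: measurableT_comp => //; apply: measurable_dot => //;
    exact: measurable_cst.
have pt t : max_abs_dot x t <= m + expR (- (l * m)) / l * \sum_(i < N) g i t.
  (* exp z >= 1 + z at z = l (y - m) *)
  have up y : y <= m + expR (- (l * m)) / l * expR (l * y).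
    rewrite mulrAC -expRD mulrC.
    have := expR_ge1Dx (- (l * m) + l * y) => e1.
    rewrite -lerBlDl -(@ler_pM2l _ l) // mulrA divff ?gt_eqF // mul1r; lra.
  have k0 : 0 <= expR (- (l * m)) / l by rewrite divr_ge0 ?expR_ge0 // ltW.
  apply/bigmax_leP; split => [|i _].
    apply: addr_ge0; first by rewrite mulr_ge0 // ltW.
    by apply: mulr_ge0 => //; apply: sumr_ge0 => i _; exact: expR_ge0.
  apply: (le_trans (up _)); rewrite lerD2l ler_wpM2l // (bigD1 i) //= lerDl.
  by apply: sumr_ge0 => j _; exact: expR_ge0.
set k := expR (- (l * m)) / l in pt.
have k0 : 0 < k by rewrite divr_gt0 ?expR_gt0.
apply: (@le_trans _ _ (\int[mu]_(t in S)
    (m%:E + k%:E * \sum_(i < N) (g i t)%:E))%E).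
  apply: ge0_le_integral => //.
  - by move=> t _; rewrite lee_fin max_abs_dot_ge0.
  - apply: measurable_funTS; apply/measurable_EFinP.
    by apply: measurable_max_abs_dot => // i; exact: measurable_cst.
  - apply: emeasurable_funD => //; apply: measurable_funeM.
    apply: emeasurable_sum => i; apply: measurable_funTS.
    exact/measurable_EFinP.
  - by move=> t _; rewrite sumEFin -EFinM -EFinD lee_fin.
have mgE i : measurable_fun S (EFin \o g i).
  by apply: measurable_funTS; exact/measurable_EFinP.
rewrite ge0_integralD //; first last.
- by apply: measurable_funeM; exact: emeasurable_sum.
- move=> t _; rewrite sumEFin -EFinM lee_fin mulr_ge0 ?sumr_ge0 ?ltW // => i _.
  exact: expR_ge0.
- by move=> t _; rewrite lee_fin mulr_ge0 // ltW.
rewrite integral_cst //= (mu_unif.1) mule1 ge0_integralZl //; first last.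
- by rewrite lee_fin ltW.
- by move=> t _; apply: sume_ge0 => i _; rewrite lee_fin expR_ge0.
- exact: emeasurable_sum.
rewrite ge0_integral_sum //; last by move=> i t _; rewrite lee_fin expR_ge0.
apply: (@le_trans _ _
  (m%:E + k%:E * \sum_(i < N) (2 * expR (l ^+ 2 / 2))%:E)%E).
  apply: leeD => //; apply: lee_wpmul2l; first by rewrite lee_fin ltW.
  by apply: lee_sum => i _; exact: integral_sphere_expR_norm_dot.
rewrite sumEFin -EFinM -EFinD lee_fin sumr_const card_ord -[_ *+ N]mulr_natl.
have -> : k * (N%:R * (2 * expR (l ^+ 2 / 2))) = 2 / l.
  rewrite /k -[N%:R]lnK ?posrE ?ltr0n // -/L -lL /m.
  transitivity (2 / l * expR (- (l * (3 / 2 * l)) + l ^+ 2 + l ^+ 2 / 2)).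
    by rewrite !expRD; field; rewrite gt_eqF.
  rewrite [X in expR X](_ : _ = 0) ?expR0 ?mulr1 //; by field.
(* l^2 = ln N >= 1 / 2 *)
have : 2 / l <= 4 * l by rewrite ler_pdivrMr // -mulrA -expr2 lL; lra.
rewrite -/l /m; lra.
Qed.

End width.

(** * Caps of the ball *)

Lemma mul_measure_le_integral d (T : measurableType d) (R : realType)
    (m : {measure set T -> \bar R}) (A : set T) (f : T -> R) (c : R) :
  0 <= c -> measurable A -> measurable_fun setT f -> (forall x, 0 <= f x) ->
  (forall x, A x -> c <= f x) -> (c%:E * m A <= \int[m]_x (f x)%:E)%E.
Proof.
move=> c0 mA mf f0 cf; rewrite -integral_cst //.
apply: (@le_trans _ _ (\int[m]_(x in A) (f x)%:E)%E).
  apply: ge0_le_integral => //.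
  by apply: measurable_funTS; exact/measurable_EFinP.
apply: ge0_subset_integral => //; first exact/measurable_EFinP.
by move=> x _; rewrite lee_fin.
Qed.

(** [N] independent events of probability at least [1 / (4 N)] all fail with
    probability at most [(1 - 1 / (4 N)) ^ N <= exp (- 1 / 4)]. *)
Lemma prob_exists_ge d (T : measurableType d) (R : realType)
    (P : probability T R) N (A : 'I_N -> set T) (p : R) :
  (0 < N)%N -> (forall i, measurable (A i)) ->
  P (\bigcap_i A i) = (\prod_(i < N) P (A i))%E ->
  (forall i, p%:E <= P (~` A i))%E -> (4 * N%:R)^-1 <= p ->
  ((1 - expR (- 4^-1))%:E <= P (~` (\bigcap_i A i)))%E.
Proof.
move=> N0 mA indep pA pN; have NR : 0 < N%:R :> R by rewrite ltr0n.
have mI : measurable (\bigcap_i A i) by apply: fin_bigcap_measurable.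
have fin i : P (A i) = (fine (P (A i)))%:E by rewrite fineK ?fin_num_measure.
rewrite probability_setC // indep EFinB; apply: leeB => //.
under eq_bigr do rewrite fin; rewrite prodEFin lee_fin.
apply: (@le_trans _ _ (\prod_(i < N) (expR (- (4 * N%:R)^-1)))).
  apply: ler_prod => i _; rewrite fine_ge0 ?measure_ge0 //=.
  have := pA i; rewrite probability_setC // fin -EFinB lee_fin => pq.
  have := expR_ge1Dx (- (4 * N%:R)^-1 : R); lra.
rewrite prodr_const card_ord -expRM_natl ler_expR.
by rewrite invfM mulrN mulrCA divff ?mulr1 // gt_eqF.
Qed.

Lemma measurable_RV_preimage d d' (T : measurableType d)
    (U : measurableType d') (R : realType) (P : probability T R)
    (X : {RV P >-> U}) (A : set U) : measurable A -> measurable (X @^-1` A).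
Proof.
by move=> mA; rewrite -[X in measurable X]setTI; exact: measurable_funP.
Qed.

Section uniform_law.
Context (R : realType) (n : nat) d (T : measurableType d) (P : probability T R).
Context (X : {RV P >-> 'rV[R]_n}) (D : set 'rV[R]_n).
Hypothesis mD : measurable D.
Hypothesis XD : uniformly_distributed X D.

Lemma uniformE (A : set 'rV[R]_n) : measurable A ->
  (P (X @^-1` A) = (volume D)^-1%:E * lebesgue_row R n (A `&` D))%E.
Proof. by move=> mA; rewrite -(XD mA). Qed.

Lemma uniform_support : (P (X @^-1` (~` D)) = 0)%E.
Proof. by rewrite uniformE ?setICl ?measure0 ?mule0 //; exact: measurableC. Qed.

(** An affine map of ratio [s] multiplies volumes by [s ^+ n]. *)
Lemma uniform_affine (s : R) (v : 'rV[R]_n) (A B : set 'rV[R]_n) : 0 < s ->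
  measurable A -> measurable B ->
  (forall x, D x -> B x -> A (s *: x + v) /\ D (s *: x + v)) ->
  ((s ^+ n)%:E * P (X @^-1` B) <= P (X @^-1` A))%E.
Proof.
move=> s0 mA mB sub; rewrite !uniformE // muleCA.
apply: lee_wpmul2l.
  by rewrite lee_fin invr_ge0 /volume fine_ge0 // measure_ge0.
rewrite (lebesgue_row_affine v s0 (measurableI _ _ mA mD)).
apply: lee_wpmul2l; first by rewrite lee_fin exprn_ge0 // ltW.
apply: le_measure; rewrite ?inE; [exact: measurableI| |].
  rewrite -[X in measurable X]setTI; apply: measurable_row_affine => //.
  exact: measurableI.
by move=> x [Bx Dx]; exact: sub.
Qed.

End uniform_law.

(** The caps at distance [h] from the center are compared with a central slab:
    one of the half slabs [0 <= +- dot x t <= 4] of the ball [D] has probability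
    at least [1 / 4], and with [u = (h^2 + 8 h) / r^2] the map
    [x |-> (1 - u) x +- h t] sends it into [D] and into the corresponding cap,
    because [(1 - u)^2 |x|^2 + 2 (1 - u) h |dot x t| + h^2 <=
    (1 - u) r^2 + 8 h + h^2 = r^2]. The map divides volumes by no more than
    [(1 - u)^- n <= exp (2 n u)]. *)
Lemma uniform_ball_cap (R : realType) n d (T : measurableType d)
    (P : probability T R) (X : {RV P >-> 'rV[R]_n}) (r h : R) (t : 'rV[R]_n) :
  0 < r -> uniformly_distributed X [set x | dot x x <= r ^+ 2] ->
  dot t t = 1 ->
  (2^-1%:E <= P (X @^-1` [set x | (`|dot x t| <= 4)%R]))%E ->
  0 <= h -> (h ^+ 2 + 8 * h) / r ^+ 2 <= 2^-1 ->
  ((4^-1 * expR (- (2 * n%:R * ((h ^+ 2 + 8 * h) / r ^+ 2))))%:E <=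
   P (X @^-1` [set x | (h <= `|dot x t|)%R]))%E.
Proof.
move=> r0 XD t1 half h0; set u := (_ / _) => u2.
have r2 : 0 < r ^+ 2 by rewrite exprn_gt0.
have u0 : 0 <= u.
  by rewrite divr_ge0 ?(ltW r2) // addr_ge0 ?sqr_ge0 // mulr_ge0.
have uE : u * r ^+ 2 = h ^+ 2 + 8 * h by rewrite divfK // gt_eqF.
pose D := [set x : 'rV[R]_n | dot x x <= r ^+ 2].
have mD : measurable D := @measurable_dot_le R n _.
(* The half slab on one side, chosen by the sign e. *)
pose G (e : bool) := [set x : 'rV[R]_n | 0 <= (-1) ^+ e * dot x t /\
   (-1) ^+ e * dot x t <= 4].
have mG e : measurable (G e).
  rewrite (_ : G e = [set x | [set y | (0 <= (-1) ^+ e * y /\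
    (-1) ^+ e * y <= 4)] (dot x t)]) //.
  apply: measurable_dot_preimage.
  have := @mulrl_measurable R setT ((-1) ^+ e) measurableT _
    (measurable_itv `[0, 4]).
  rewrite setTI; congr measurable; apply/funext => y /=; rewrite in_itv /=.
  by apply/propext; split => /andP.
have mXG e : measurable (X @^-1` G e) := measurable_RV_preimage X (mG e).
have [e Ge] : exists e, (4^-1%:E <= P (X @^-1` G e))%E.
  apply: contrapT => /forallNP no.
  have : (P (X @^-1` [set x | (`|dot x t| <= 4)%R]) <=
      P (X @^-1` G false) + P (X @^-1` G true))%E.
    apply: le_trans (measureU2 _ (mXG false) (mXG true)).
    apply: le_measure; rewrite ?inE.
    - by apply: (measurable_RV_preimage X); exact: measurable_slab.
    - exact: measurableU.
    move=> w /=; rewrite /G /= expr0 expr1 mul1r mulN1r.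
    by case: (ger0P (dot (X w) t)) => h1 h2; [left|right]; split => //; lra.
  have fin e : P (X @^-1` G e) \is a fin_num by exact/fin_num_measure.
  move: (no true) (no false) half.
  rewrite -(fineK (fin true)) -(fineK (fin false)).
  move=> /negP; rewrite -ltNge lte_fin => n1.
  move=> /negP; rewrite -ltNge lte_fin => n2.
  by move=> half /(le_trans half); rewrite -EFinD lee_fin; lra.
pose s := 1 - u; have s0 : 0 < s by rewrite /s; lra.
have su : expR (- (2 * u)) <= s.
  by rewrite expRN -[s]invrK lef_pV2 ?posrE ?expR_gt0 ?invr_gt0 // inv_le_expR.
have mcap := measurable_caps t h.
apply: le_trans
  (uniform_affine mD XD (v := ((-1) ^+ e * h) *: t) s0 mcap (mG e) _).
  rewrite EFinM muleC; apply: lee_pmul => //; rewrite ?lee_fin ?expR_ge0 //.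
  rewrite (_ : - _ = n%:R * - (2 * u)); last by ring.
  by rewrite expRM_natl lerXn2r // nnegrE ?expR_ge0 ?ltW.
move=> x; rewrite /D /G /= => Dx [G0 G4]; split.
  rewrite dotDl !dotZl t1 mulr1.
  apply: (@le_trans _ _ ((-1) ^+ e * (s * dot x t + (-1) ^+ e * h))).
    rewrite mulrDr [X in _ + X]mulrA -expr2 sqrr_sign mul1r mulrCA lerDr.
    by rewrite mulr_ge0 // ltW.
  by rewrite (le_trans (ler_norm _)) // normrM normr_sign mul1r.
rewrite !dotDl !dotDr !dotZl !dotZr t1 mulr1 (dotC t x).
set y := (-1) ^+ e * dot x t in G0 G4.
rewrite [leLHS](_ : _ = s * (s * dot x x) + 2 * s * h * y + h ^+ 2);
  last first.
  have := sqrr_sign R e; rewrite /y; set sg := (-1) ^+ e => sg2.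
  by ring: sg2.
have s1 : s <= 1 by rewrite /s; lra.
have x2 : s * (s * dot x x) <= s * r ^+ 2.
  apply: ler_wpM2l; first exact: ltW.
  by rewrite (le_trans _ Dx) // ler_piMl // dot_ge0.
have hy : 2 * s * h * y <= 8 * h.
  have : s * h * y <= 1 * h * 4.
    by apply: ler_pM => //; [rewrite mulr_ge0 // ltW|rewrite ler_wpM2r].
  by lra.
rewrite [leRHS](_ : _ = s * r ^+ 2 + u * r ^+ 2); last by rewrite /s; ring.
by rewrite uE; lra.
Qed.

(** * The expected mean width *)

(** The factor in the height [lower_const R * sqrt (ln N)] of the caps. Caps of
    height [h] lose a factor [exp (- 2 C^2 (h^2 + 8 h))] with
    [C = ball_const R], and [h^2 + 8 h <= 17 (h / sqrt (ln N)) ln N]; the value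
    [1 / (34 C^2)] makes the loss at most [1 / N]. *)
Definition lower_const (R : realType) : R := (34 * ball_const R ^+ 2)^-1.

Lemma lower_const_gt0 (R : realType) : 0 < lower_const R.
Proof.
have := ball_const_ge1 R; rewrite /lower_const => C1.
by rewrite invr_gt0 mulr_gt0 // exprn_gt0 //; lra.
Qed.

Section expected_mean_width.
Context (R : realType) (n N : nat).
Context d (T : measurableType d) (P : probability T R).
Context (X : 'I_N -> {RV P >-> 'rV[R]_n}) (r : R).
Hypotheses (n0 : (0 < n)%N) (N1 : (1 < N)%N).
Let D := [set x : 'rV[R]_n | dot x x <= r ^+ 2].
Hypothesis XD : forall i, uniformly_distributed (X i) D.
Context (mu : probability 'rV[R]_n R).
Hypothesis mu_unif : uniform_on_sphere mu.
Hypothesis rle : r ^+ 2 <= n%:R / 4.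
Notation S := (@euclidean_sphere R n).
Notation M w t := (max_abs_dot (fun i => X i w) t).

Let N0 : (0 < N)%N := ltnW N1.
Let mS := @measurable_euclidean_sphere R n.
Let mD : measurable D := @measurable_dot_le R n _.

Lemma expectation_mean_widthE :
  ('E_P[fun w => mean_width mu (random_polytope (fun i => X i w))] =
   \int[P]_w \int[mu]_(t in S) (M w t)%:E)%E.
Proof.
by rewrite unlock; apply: eq_integral => w _; rewrite mean_widthE.
Qed.

Lemma measurable_max_abs_dot_pair :
  measurable_fun setT (fun p : T * 'rV[R]_n => M p.1 p.2).
Proof.
apply: measurable_max_abs_dot => [i|]; last exact: measurable_snd.
by apply: measurableT_comp => //; exact: measurable_fst.
Qed.

Lemma measurable_sphere_indic_snd :
  measurable_fun setT (fun p : T * 'rV[R]_n => \1_S p.2 : R).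
Proof.
by apply: measurableT_comp; [exact: measurable_indic|exact: measurable_snd].
Qed.

(** Tonelli's theorem concerns integrals over whole spaces, so the sphere enters
    as an indicator. *)
Lemma integral_sphere_indic (f : 'rV[R]_n -> R) :
  (\int[mu]_(t in S) (f t)%:E = \int[mu]_t (f t * \1_S t)%:E)%E.
Proof.
rewrite integral_mkcond; apply: eq_integral => t _ /=.
by rewrite patchE indicE; case: ifPn => _; rewrite ?mulr1 ?mulr0.
Qed.

Lemma measurable_integral_max_abs_dot :
  measurable_fun setT (fun w => \int[mu]_(t in S) (M w t)%:E)%E.
Proof.
under eq_fun do rewrite integral_sphere_indic.
apply: (measurable_fun_fubini_tonelli_F
  (fun p : T * 'rV[R]_n => (M p.1 p.2 * \1_S p.2)%:E)).
  apply/measurable_EFinP; apply: measurable_funM.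
    exact: measurable_max_abs_dot_pair.
  exact: measurable_sphere_indic_snd.
by move=> p; rewrite lee_fin mulr_ge0 // max_abs_dot_ge0.
Qed.

Lemma expectation_mean_width_le :
  ('E_P[fun w => mean_width mu (random_polytope (fun i => X i w))] <=
   (11 / 2 * Num.sqrt (ln N%:R))%:E)%E.
Proof.
rewrite expectation_mean_widthE; set c := 11 / 2 * _.
have c0 : 0 <= c by rewrite mulr_ge0 // sqrtr_ge0.
apply: (@le_trans _ _ (\int[P]_w (cst c%:E w))%E);
  last by rewrite integral_cst //= probability_setT mule1.
apply: ae_ge0_le_integral => //.
- by move=> w _; apply: integral_ge0 => t _; rewrite lee_fin max_abs_dot_ge0.
- exact: measurable_integral_max_abs_dot.
have : {ae P, forall w, forall i, D (X i w)}.
  apply: filter_forall => i; exists (X i @^-1` (~` D)); split => //.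
    exact/measurable_RV_preimage/measurableC.
  exact: (uniform_support mD (XD i)).
apply: filterS => w Dw _; apply: integral_max_abs_dot_le => // i.
exact: le_trans (Dw i) rle.
Qed.

Hypothesis Nn : N%:R <= expR n%:R :> R.
Hypotheses (r0 : 0 < r) (rge : n%:R / ball_const R ^+ 2 <= r ^+ 2).
Hypothesis indX : mutually_independent X.

Let h : R := lower_const R * Num.sqrt (ln N%:R).
Let q : R := 1 - expR (- 4^-1).
Let c : R := h * q.
Let X0 := X (Ordinal N0).

Let h0 : 0 <= h.
Proof. by rewrite mulr_ge0 ?sqrtr_ge0 // ltW // lower_const_gt0. Qed.

Let c0 : 0 <= c.
Proof. by rewrite mulr_ge0 // subr_ge0 expR_le1; lra. Qed.

Lemma cap_height_le : 2 * n%:R * ((h ^+ 2 + 8 * h) / r ^+ 2) <= ln N%:R.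
Proof.
have C1 := ball_const_ge1 R; have L2 := @ln_nat_ge R N N1.
have C2 : 1 <= ball_const R ^+ 2.
  by rewrite -[1](expr1n _ 2) lerXn2r // nnegrE; lra.
have a0 := lower_const_gt0 R.
set a := lower_const R in a0; set L := ln N%:R in L2 *.
set C := ball_const R ^+ 2 in C2.
have aC : a * C = 34^-1.
  by rewrite /a /lower_const -/C invfM -mulrA mulVf ?mulr1 // gt_eqF //; lra.
have l0 : 0 <= Num.sqrt L := sqrtr_ge0 L.
have lL : Num.sqrt L ^+ 2 = L by rewrite sqr_sqrtr //; lra.
have r2 : 0 < r ^+ 2 by rewrite exprn_gt0.
have nC : n%:R <= r ^+ 2 * C by rewrite -ler_pdivrMr //; lra.
rewrite mulrA ler_pdivrMr //.
have a1 : a <= 1 by nra.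
(* L >= 1 / 2 *)
have l2 : Num.sqrt L <= 2 * L by nra.
have h17 : h ^+ 2 + 8 * h <= 17 * a * L.
  rewrite /h -/L -/a exprMn lL.
  have : a ^+ 2 * L <= a * L.
    by rewrite ler_wpM2r //; [lra|rewrite expr2 ler_piMr // ltW].
  have : a * Num.sqrt L <= a * (2 * L) by rewrite ler_wpM2l // ltW.
  by lra.
apply: (@le_trans _ _ (2 * (r ^+ 2 * C) * (17 * a * L))).
  apply: ler_pM => //; last by rewrite ler_wpM2l.
  by apply: addr_ge0; [exact: sqr_ge0|exact: mulr_ge0].
rewrite [leLHS](_ : _ = 34 * (a * C) * (L * r ^+ 2)); last by ring.
by rewrite aC mulfV ?mul1r.
Qed.

(** In a direction in which the marginal of the uniform law is not spread out,
    each point falls in the two caps of height [h] with probability at least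
    [1 / (4 N)], so by independence one of the [N] points does with probability
    at least [q]. *)
Lemma integral_max_abs_dot_ge (t : 'rV[R]_n) : dot t t = 1 ->
  (2^-1%:E <= P (X0 @^-1` [set x | (`|dot x t| <= 4)%R]))%E ->
  (c%:E <= \int[P]_w (M w t)%:E)%E.
Proof.
move=> t1 half; have hL := cap_height_le.
pose cap := [set x : 'rV[R]_n | h <= `|dot x t|].
have mcap : measurable cap := measurable_caps t h.
pose A i := X i @^-1` (~` cap).
have mA i : measurable (A i) by exact/measurable_RV_preimage/measurableC.
have nR : 0 < n%:R :> R by rewrite ltr0n.
pose u := (h ^+ 2 + 8 * h) / r ^+ 2.
have Ln : ln N%:R <= n%:R :> R by rewrite -ler_expR lnK // posrE ltr0n.
have u2 : u <= 2^-1 by have := le_trans hL Ln; rewrite -/u; nra.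
have qA : (q%:E <= P (~` (\bigcap_i A i)))%E.
  apply: (@prob_exists_ge _ _ _ _ _ _ (4^-1 * expR (- (2 * n%:R * u)))) => //.
  - have := @indX [set: 'I_N]%SET (fun=> ~` cap) (fun=> measurableC mcap).
    rewrite (_ : \bigcap_(i in _) _ = \bigcap_i A i).
      by move=> ->; apply: eq_bigl => i; rewrite inE.
    by apply/seteqP; split => w Aw i _; apply: Aw => //=; rewrite inE.
  - move=> i; rewrite /A preimage_setC setCK.
    apply: (uniform_ball_cap r0 (XD i) t1) => //.
    rewrite (uniformE (XD i)); last exact: measurable_slab.
    by rewrite -(uniformE (XD (Ordinal N0))) //; exact: measurable_slab.
  - rewrite invfM ler_pM2l // -[N%:R]lnK ?posrE ?ltr0n // -expRN.
    by rewrite ler_expR lerN2.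
apply: (@le_trans _ _ (h%:E * P (~` (\bigcap_i A i)))%E).
  by rewrite EFinM; apply: lee_wpmul2l => //; rewrite lee_fin.
apply: mul_measure_le_integral => //.
- by apply: measurableC; apply: fin_bigcap_measurable.
- exact: measurable_max_abs_dot.
- by move=> w; exact: max_abs_dot_ge0.
move=> w; rewrite setC_bigcap => -[i _]; rewrite /A preimage_setC setCK => hi.
exact: (le_trans hi (abs_dot_le_max (fun i => X i w) t i)).
Qed.

(** At least [2 c] once the marginal in direction [t] exceeds [4], which pays
    for the directions in which that is likely; its mean over the sphere is
    small. *)
Definition penalty (w : T) (t : 'rV[R]_n) : R :=
  2 * c * expR (- 16) * expR (4 * `|dot (X0 w) t|).

Lemma penalty_ge0 w t : 0 <= penalty w t.
Proof. by rewrite mulr_ge0 ?expR_ge0 // mulr_ge0 ?expR_ge0 // mulr_ge0. Qed.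

Lemma measurable_penalty d' (U : measurableType d') (f : U -> T)
    (g : U -> 'rV[R]_n) : measurable_fun setT f -> measurable_fun setT g ->
  measurable_fun setT (fun u => penalty (f u) (g u)).
Proof.
move=> mf mg; apply: measurable_funM => //; apply: measurableT_comp => //.
apply: measurable_funM => //; apply: measurableT_comp => //.
by apply: measurable_dot => //; exact: measurableT_comp.
Qed.

Lemma integral_max_penalty_ge (t : 'rV[R]_n) : dot t t = 1 ->
  (c%:E <= \int[P]_w (M w t + penalty w t)%:E)%E.
Proof.
move=> t1; have mslab := measurable_slab t 4.
have mM : measurable_fun setT (fun w => M w t).
  exact: measurable_max_abs_dot.
have mp : measurable_fun setT (penalty ^~ t) by exact: measurable_penalty.
have [half|half] :=
  leP (2^-1%:E)%E (P (X0 @^-1` [set x | (`|dot x t| <= 4)%R])).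
  apply: (le_trans (integral_max_abs_dot_ge t1 half)).
  apply: ge0_le_integral => //.
  - by move=> w _; rewrite lee_fin max_abs_dot_ge0.
  - exact/measurable_EFinP.
  - by apply/measurable_EFinP; exact: measurable_funD.
  - by move=> w _; rewrite lee_fin lerDl penalty_ge0.
pose A := ~` (X0 @^-1` [set x | `|dot x t| <= 4]).
have mX : measurable (X0 @^-1` [set x | `|dot x t| <= 4]).
  exact: measurable_RV_preimage.
have PA : (2^-1%:E <= P A)%E.
  rewrite probability_setC //; move: half.
  have := fin_num_measure P _ mX; case: (P _) => // y _.
  by rewrite -EFinB lte_fin lee_fin; lra.
apply: (@le_trans _ _ ((2 * c)%:E * P A)%E).
  apply: (@le_trans _ _ ((2 * c)%:E * 2^-1%:E)%E).
    by rewrite -EFinM lee_fin; lra.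
  by apply: lee_wpmul2l => //; rewrite lee_fin mulr_ge0.
apply: mul_measure_le_integral => //.
- by rewrite mulr_ge0.
- exact: measurableC.
- exact: measurable_funD.
- by move=> w; rewrite addr_ge0 ?penalty_ge0 // max_abs_dot_ge0.
move=> w /negP; rewrite -ltNge => w4.
apply: (@le_trans _ _ (penalty w t)); last by rewrite lerDr max_abs_dot_ge0.
rewrite /penalty -mulrA -expRD; apply: ler_peMr; first exact: mulr_ge0.
by apply: le_trans (expR_ge1Dx _); lra.
Qed.

Lemma integral_penalty_le w : D (X0 w) ->
  (\int[mu]_(t in S) (penalty w t)%:E <= (c / 2)%:E)%E.
Proof.
move=> Dw; set k := 2 * c * expR (- 16).
have k0 : 0 <= k by rewrite mulr_ge0 ?expR_ge0 // mulr_ge0.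
under eq_integral do rewrite EFinM.
rewrite ge0_integralZl //; last first.
  apply: measurable_funTS; apply/measurable_EFinP.
  apply: measurableT_comp => //; apply: measurable_funM => //.
  apply: measurableT_comp => //.
  by apply: measurable_dot => //; exact: measurable_cst.
have := integral_sphere_expR_norm_dot mu_unif 4 n0 (le_trans Dw rle).
move=> /(@lee_wpmul2l _ k%:E _) bnd; apply: (le_trans (bnd _)).
  by rewrite lee_fin.
rewrite -EFinM lee_fin /k.
rewrite [leLHS](_ : _ = 4 * c * (expR (- 16) * expR (4 ^+ 2 / 2)));
  last by ring.
rewrite -expRD (_ : - 16 + _ = - 8); last by field.
have : expR (- 8) <= 8^-1 :> R.
  rewrite expRN lef_pV2 ?posrE ?expR_gt0 //.
  by have := expR_ge1Dx (8 : R); lra.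
by have := c0; nra.
Qed.

(** Adding the penalty gives a function whose expectation is at least [c] in
    every direction. After an exchange of the integrals, the penalty accounts
    for at most [c / 2]. *)
Lemma expectation_mean_width_ge :
  ((c / 2)%:E <=
   'E_P[fun w => mean_width mu (random_polytope (fun i => X i w))])%E.
Proof.
rewrite expectation_mean_widthE; set E := (\int[P]_w _)%E.
pose F (p : T * 'rV[R]_n) := (M p.1 p.2 + penalty p.1 p.2) * \1_S p.2.
have F0 p : 0 <= F p.
  by rewrite mulr_ge0 // addr_ge0 ?penalty_ge0 // max_abs_dot_ge0.
have mF : measurable_fun setT (EFin \o F).
  apply/measurable_EFinP; apply: measurable_funM.
    apply: measurable_funD; first exact: measurable_max_abs_dot_pair.
    exact: measurable_penalty measurable_fst measurable_snd.
  exact: measurable_sphere_indic_snd.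
have direction t : (c%:E * (\1_S t)%:E <= \int[P]_w (F (w, t))%:E)%E.
  rewrite /F /= indicE; have [|_] := boolP (t \in S); last first.
    by rewrite mule0; apply: integral_ge0 => w _; rewrite mulr0.
  rewrite mule1 inE euclidean_sphereE /= => t1.
  under eq_integral do rewrite mulr1.
  exact: integral_max_penalty_ge.
have muS : (mu S = 1)%E := mu_unif.1.
have ge : (c%:E <= \int[P]_w \int[mu]_t (F (w, t))%:E)%E.
  rewrite (fubini_tonelli (EFin \o F)) //.
  apply: (@le_trans _ _ (\int[mu]_t (c%:E * (\1_S t)%:E))%E).
    rewrite ge0_integralZl //.
      by rewrite integral_indic // setIT [X in (_ * X)%E]muS mule1.
    by apply/measurable_EFinP; exact: measurable_indic.
  apply: ge0_le_integral => //.
  - by move=> t _; rewrite -EFinM lee_fin mulr_ge0.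
  - by apply/measurable_funeM/measurable_EFinP; exact: measurable_indic.
  - exact: (measurable_fun_fubini_tonelli_G (EFin \o F)).
have le : (\int[P]_w \int[mu]_t (F (w, t))%:E <= E + (c / 2)%:E)%E.
  have c20 : 0 <= c / 2 by rewrite divr_ge0.
  rewrite (_ : (c / 2)%:E = \int[P]_w (cst (c / 2)%:E w))%E; last first.
    by rewrite integral_cst //= probability_setT mule1.
  have I0 w : (0 <= \int[mu]_(t in S) (M w t)%:E)%E.
    by apply: integral_ge0 => t _; rewrite lee_fin max_abs_dot_ge0.
  have mI := measurable_integral_max_abs_dot.
  rewrite /E -ge0_integralD //.
  apply: ae_ge0_le_integral => //.
  - by move=> w _; apply: integral_ge0 => t _; rewrite lee_fin.
  - exact: (measurable_fun_fubini_tonelli_F (EFin \o F)).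
  - by move=> w _; rewrite adde_ge0 ?lee_fin.
  - exact: emeasurable_funD.
  exists (X0 @^-1` (~` D)); split.
  - exact/measurable_RV_preimage/measurableC.
  - exact: (uniform_support mD (XD _)).
  apply: subsetCl; rewrite -preimage_setC setCK => w Dw _ /=.
  rewrite -(integral_sphere_indic (fun t => M w t + penalty w t)).
  under eq_integral do rewrite EFinD.
  rewrite ge0_integralD //; first last.
  - apply: measurable_funTS; apply/measurable_EFinP.
    exact: (@measurable_penalty _ _ (fun=> w) id).
  - by move=> t _; rewrite lee_fin penalty_ge0.
  - apply: measurable_funTS; apply/measurable_EFinP.
    by apply: measurable_max_abs_dot => // i; exact: measurable_cst.
  - by move=> t _; rewrite lee_fin max_abs_dot_ge0.
  by apply: leeD => //; exact: integral_penalty_le.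
have := le_trans ge le.
by case: (E) => [y| |] //; rewrite -?EFinD ?lee_fin ?leey // => ?; lra.
Qed.

End expected_mean_width.

Theorem corollary1p2 (R : realType) :
  exists c1 c2 : R, [/\ 0 < c1, 0 < c2 &
  forall (n N : nat) (mu : probability 'rV[R]_n R)
    (d : measure_display) (T : measurableType d) (P : probability T R)
    (X : 'I_N -> {RV P >-> 'rV[R]_n}),
  (0 < n)%N -> (n <= N)%N -> (1 < N)%N -> N%:R <= expR n%:R :> R ->
  uniform_on_sphere mu ->
  mutually_independent X ->
  (forall i, uniformly_distributed (X i) (@unit_volume_ball R n)) ->
  ((c1 * Num.sqrt (ln N%:R))%:E
    <= 'E_P[fun w => mean_width mu (random_polytope (fun i => X i w))]
    <= (c2 * Num.sqrt (ln N%:R))%:E)%E].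
Proof.
have q0 : 0 < 1 - expR (- 4^-1) :> R by rewrite subr_gt0 expR_lt1; lra.
exists (lower_const R * (1 - expR (- 4^-1)) / 2), (11 / 2); split => //.
  by rewrite divr_gt0 // mulr_gt0 // lower_const_gt0.
move=> n N mu d T P X n0 _ N1 Nn mu_unif indX XD.
have [r [r0 rge rle DE]] := unit_volume_ballE R n0; rewrite DE in XD.
apply/andP; split; last exact: expectation_mean_width_le.
have := expectation_mean_width_ge n0 N1 XD mu_unif rle Nn r0 rge indX.
by congr (_%:E <= _)%E; ring.
Qed.
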